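(* Let $\mathcal{C}$ be a family of positive random variables in which one can find a sequence converging in distribution to a positive constant $c>0$. Then the class $$\mathcal{D}=\{Y/\Theta \mid \Theta\in\mathcal{C},\ Y \text{ phase-type distributed},\ Y \text{ independent of } \Theta\}$$ is weakly dense in the class of distributions on the positive half-line. In other words, for any given positive random variable $Z$ there exists a sequence $\{X_n\}_{n=1}^\infty\subset\mathcal{D}$ such that $X_n\to Z$ in distribution as $n\to\infty$.
   Context: A random variable $Y$ is phase-type (PH) distributed, $Y\sim\mathrm{PH}(\boldsymbol{\pi},\boldsymbol{T})$, if it is the time until absorption of a time-homogeneous Markov jump process on a finite state space $\{1,\dots,p,p+1\}$ with $1,\dots,p$ transient and $p+1$ absorbing, with initial distribution $\boldsymbol{\pi}=(\pi_1,\dots,\pi_p)$ on the transient states (no mass at $p+1$) and sub-intensity matrix $\boldsymbol{T}$ among the transient states. The number of transient states $p\ge 1$ is arbitrary, and varies over all possibilities in the definition of $\mathcal{D}$. Elements of $\mathcal{D}$ matter only through their distributions. *)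

(* Defs.v *)
From HB Require Import structures.
From mathcomp Require Import all_boot all_order all_algebra.
From mathcomp Require Import all_classical all_reals all_analysis.
Set Implicit Arguments.
Unset Strict Implicit.
Unset Printing Implicit Defensive.
Import Order.TTheory GRing.Theory Num.Theory.
Import numFieldNormedType.Exports.
Local Open Scope classical_set_scope.
Local Open Scope ring_scope.

(* A real random variable bundled with its probability space, so that families
   and sequences of random variables need not live on a common space. *)
Record rvar (R : realType) := RVar {
  rv_disp : measure_display;
  rv_space : measurableType rv_disp;
  rv_prob : probability rv_space R;
  rv_fun : {RV rv_prob >-> R}
}.

Definition const_rvar (R : realType) (c : R) : rvar R :=
  @RVar R _ unit (\d_tt : probability unit R) (cst c : {mfun unit >-> R}).

Definition positive_rvar (R : realType) (X : rvar R) : Prop :=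
  rv_prob X [set w | 0 < rv_fun X w] = 1%E.

Definition rvar_cdf (R : realType) (X : rvar R) : R -> \bar R :=
  cdf (rv_fun X).

Definition cvg_in_distribution (R : realType) (X : nat -> rvar R)
    (Z : rvar R) : Prop :=
  forall x : R, {for x, continuous (rvar_cdf Z)} ->
    rvar_cdf (X n) x @[n --> \oo] --> rvar_cdf Z x.

Definition eq_in_law (R : realType) d1 d2
    (T1 : measurableType d1) (T2 : measurableType d2)
    (P1 : probability T1 R) (P2 : probability T2 R)
    (X1 : {RV P1 >-> R}) (X2 : {RV P2 >-> R}) : Prop :=
  forall A : set R, measurable A ->
    distribution P1 X1 A = distribution P2 X2 A.

Definition independent_rv (R : realType) d (T : measurableType d)
    (P : probability T R) (X Y : {RV P >-> R}) : Prop :=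
  forall A B : set R, measurable A -> measurable B ->
    P ((X @^-1` A) `&` (Y @^-1` B)) = (P (X @^-1` A) * P (Y @^-1` B))%E.

(* The transition probabilities of a homogeneous Markov jump process with
   finite state space 'I_n and intensity matrix Q. *)
Record transition_semigroup (R : realType) (n : nat) (Q : 'M[R]_n)
    (Pt : R -> 'M[R]_n) : Prop := {
  tsg_ge0 : forall t i j, 0 <= t -> 0 <= Pt t i j;
  tsg_sum1 : forall t i, 0 <= t -> \sum_j Pt t i j = 1;
  tsg_id : Pt 0 = 1%:M;
  tsg_chapman_kolmogorov :
    forall s t, 0 <= s -> 0 <= t -> Pt (s + t) = Pt s *m Pt t;
  tsg_intensity : forall i j,
    (Pt h i j - (1%:M : 'M[R]_n) i j) / h @[h --> 0^'+] --> Q i j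
}.

(* mjp_markov is the homogeneous Markov property
     P(J_(t_(k+1)) = i_(k+1) | J_(t_0) = i_0, ..., J_(t_k) = i_k)
       = Pt (t_(k+1) - t_k) i_k i_(k+1)
   multiplied out, so that conditioning events of probability 0 are harmless.
   The path conditions say that each path is a step function with finitely many
   jumps on bounded intervals. J is only meaningful at nonnegative times. *)
Record markov_jump_process (R : realType) d (T : measurableType d)
    (P : probability T R) (n : nat) (J : R -> T -> 'I_n)
    (alpha : 'rV[R]_n) (Pt : R -> 'M[R]_n) : Prop := {
  mjp_measurable : forall t i, 0 <= t -> measurable [set w | J t w = i];
  mjp_init : forall i, P [set w | J 0 w = i] = (alpha ord0 i)%:E;
  mjp_markov : forall (k : nat) (t : nat -> R) (i : nat -> 'I_n),
    0 <= t 0%N -> (forall l : nat, (l <= k)%N -> t l < t l.+1) ->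
    P [set w | forall l : nat, (l <= k.+1)%N -> J (t l) w = i l] =
    (P [set w | forall l : nat, (l <= k)%N -> J (t l) w = i l] *
     (Pt (t k.+1 - t k) (i k) (i k.+1))%:E)%E;
  mjp_right_continuous : forall w t, 0 <= t ->
    \forall s \near t^'+, J s w = J t w;
  mjp_left_limit : forall w t, 0 < t ->
    exists i, \forall s \near t^'-, J s w = i
}.

(* Started from i, the set of times spent in i is almost surely bounded. *)
Definition transient_state (R : realType) (n : nat) (Pt : R -> 'M[R]_n)
    (i : 'I_n) : Prop :=
  forall (d : measure_display) (T : measurableType d) (P : probability T R)
    (J : R -> T -> 'I_n),
    markov_jump_process P J (delta_mx ord0 i) Pt ->
    {ae P, forall w, exists s : R, forall t, s <= t -> J t w <> i}.

(* Below, the state space is 'I_(p + 1): the states lshift 1 i for i : 'I_p are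
   the transient ones, and absorbing_state p is the absorbing one. *)
Definition absorbing_state (p : nat) : 'I_(p + 1) := rshift p ord0.

Definition sub_intensity (R : realType) (p : nat) (T : 'M[R]_p) : Prop :=
  (forall i j, i != j -> 0 <= T i j) /\ (forall i, \sum_j T i j <= 0).

Definition full_intensity (R : realType) (p : nat) (T : 'M[R]_p) :
    'M[R]_(p + 1) :=
  block_mx T (- (T *m const_mx 1)) 0 0.

Definition absorption_time (R : realType) (W : Type) (p : nat)
    (J : R -> W -> 'I_(p + 1)) (w : W) : \bar R :=
  ereal_inf [set t%:E | t in [set t | 0 <= t /\ J t w = absorbing_state p]].

(* Y ~ PH(pi, T), as a property of the law of Y: the jump process whose
   absorption time tau has that law may live on another probability space. *)
Definition PH (R : realType) (p : nat) (pi : 'rV[R]_p) (T : 'M[R]_p)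
    dY (OmegaY : measurableType dY) (PY : probability OmegaY R)
    (Y : {RV PY >-> R}) : Prop :=
  [/\ (0 < p)%N,
      (forall i, 0 <= pi ord0 i) /\ \sum_i pi ord0 i = 1,
      sub_intensity T &
  exists Pt : R -> 'M[R]_(p + 1),
  [/\ transition_semigroup (full_intensity T) Pt,
      (forall i : 'I_p, transient_state Pt (lshift 1 i)) &
  exists (d : measure_display) (Omega : measurableType d)
    (P : probability Omega R) (J : R -> Omega -> 'I_(p + 1))
    (tau : {RV P >-> R}),
  [/\ markov_jump_process P J (row_mx pi 0) Pt,
      {ae P, forall w, (tau w)%:E = absorption_time J w} &
      eq_in_law tau Y]]].

Definition phase_type (R : realType) dY (OmegaY : measurableType dY)
    (PY : probability OmegaY R) (Y : {RV PY >-> R}) : Prop :=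
  exists (p : nat) (pi : 'rV[R]_p) (T : 'M[R]_p), PH pi T Y.

(* The random variables Y / Theta' where Theta' is a copy in law of a member of
   C: a copy is needed because the space carrying the member of C need not
   support an independent phase-type variable. Families of rvar are plain
   predicates, since [set (rvar R)] is a universe inconsistency. *)
Definition PH_ratio_class (R : realType) (C : rvar R -> Prop)
    (X : rvar R) : Prop :=
  exists2 Theta : rvar R, C Theta &
    exists Y Theta' : {RV (rv_prob X) >-> R},
    [/\ phase_type Y, eq_in_law Theta' (rv_fun Theta),
        independent_rv Y Theta' &
        forall w, rv_fun X w = Y w / Theta' w].

(* Main.v *)
Require Import Defs.
From HB Require Import structures.
From mathcomp Require Import all_boot all_order all_algebra.
From mathcomp Require Import all_classical all_reals all_analysis.
From mathcomp Require Import perm measurable_realfun ring lra.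
Import Order.TTheory GRing.Theory Num.Theory.
Import numFieldNormedType.Exports.
Local Open Scope classical_set_scope.
Local Open Scope ring_scope.

(** As Theta_n is close to the constant c, it suffices to approximate c Z by
    phase-type variables. Given z, the maximum of about e^(a c z) independent
    Exp(a) lifetimes has distribution function close to
    exp (- e^(a (c z - y))), which tends to the indicator of [y > c z] as
    a -> oo. So let Y_a be the last death among the particles 0 <= i < k with
    i <= e^(a c Z), where k = k(a) grows fast enough. The set of particles alive
    is a Markov jump process on the subsets of {0, ..., k - 1}, absorbed at the
    empty set at time Y_a: it is a product of independent two-state chains, so
    its transition probabilities and the Markov property factor over the
    particles, and the randomness of Z only enters through the initial state.
    Hence Y_a is phase-type, and Y_a / Theta_n with Theta_n independent of
    (Z, Y_a) converges to Z in distribution. *)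

Set Implicit Arguments.
Unset Strict Implicit.
Unset Printing Implicit Defensive.

(** * Independent exponential lifetimes *)

(** The law of a lifetime enters the rest of the proof only through this tail. The statement is a
    [sig], so that [sval] yields laws for a whole sequence of rates. *)
Lemma exponential_law (R : realType) (a : R) : 0 < a ->
  {mu : probability (measurableTypeR R) R |
    forall t, 0 <= t -> mu `]t, +oo[%classic = (expR (- (a * t)))%:E}.
Proof.
move=> a0.
have mu : {mu : probability (measurableTypeR R) R |
    mu = exponential_prob a :> (set _ -> _)}.
  by unshelve (eexists; reflexivity).
case: mu => mu muE; exists mu => t t0.
have neg0 : mu `]-oo, 0[%classic = 0%E.
  rewrite muE; apply: integral0_eq => x /=; rewrite in_itv/= => x0.
  by rewrite lt0_exponential_pdf.
have pos s : 0 < s -> mu `]-oo, s]%classic = (1 - expR (- (a * s)))%:E.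
  move=> s0; have -> : `]-oo, s]%classic = `]-oo, 0[ `|` `[0, s].
    apply/seteqP; split => x /=; rewrite !in_itv/=.
      by move=> xs; case: (ltP x 0) => x0; [left|right].
    by case=> [x0|/andP[]//]; apply: ltW; exact: lt_trans s0.
  rewrite measureU//; last first.
    apply/seteqP; split => x //=; rewrite !in_itv/= => -[x0 /andP[x0' _]].
    by move: x0; rewrite ltNge x0'.
  rewrite [X in (X + _)%E]neg0 add0e -mulNr EFinB -exponential_prob_itv0c//.
  by rewrite -muE.
have le0 : mu `]-oo, t]%classic = (1 - expR (- (a * t)))%:E.
  move: t0; rewrite le_eqVlt => /orP[/eqP <-|]; last exact: pos.
  rewrite mulr0 oppr0 expR0 subrr; apply/eqP; rewrite eq_le measure_ge0 andbT.
  (* At 0, the mass of []-oo, 0]] is at most that of []-oo, e / a]], which is [1 - expR (- e) <= e]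
     for every [e > 0]. *)
  apply/lee_addgt0Pr => e e0; rewrite add0e.
  have s0 : 0 < e / a by rewrite divr_gt0.
  apply: (@le_trans _ _ (mu `]-oo, e / a]%classic)).
    by rewrite le_measure ?inE//; apply: subset_itvl; rewrite bnd_simp ltW.
  rewrite pos// lee_fin mulrC divfK ?gt_eqF//.
  by have := expR_ge1Dx (- e); lra.
have -> : `]t, +oo[%classic = ~` `]-oo, t] by rewrite setCitvl.
by rewrite probability_setC// le0 -EFinB; congr (_%:E); lra.
Qed.

(** Each phase-type variable involves finitely many particles, so a finite product space suffices.
    Lifetimes are indexed by [nat] to keep ordinals out of the induction on [k]; no law is imposed
    on the indices from [k] on. *)
Record iid_model (R : realType) (mu : probability (measurableTypeR R) R)
    (k : nat) := IidModel {
  iid_disp : measure_display;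
  iid_space : measurableType iid_disp;
  iid_prob : probability iid_space R;
  iid_fun : nat -> iid_space -> R;
  iid_measurable : forall i, measurable_fun [set: iid_space] (iid_fun i);
  iid_law : forall A : nat -> set R, (forall i, measurable (A i)) ->
    iid_prob [set w | forall i, (i < k)%N -> A i (iid_fun i w)] =
    (\prod_(i < k) mu (A i))%E
}.

Arguments iid_prob {R mu k} _.
Arguments iid_fun {R mu k} _.
Arguments iid_measurable {R mu k} _.
Arguments iid_law {R mu k} _.

(* Lives in Type, so that one can form a sequence of models without choice. *)
Lemma iid_model_exists (R : realType) (mu : probability (measurableTypeR R) R)
  (k : nat) : iid_model mu k.
Proof.
elim: k => [|k [d T P E mE lawE]].
  exists _ unit (\d_tt : probability unit R) (fun _ => cst 0) => // A mA.
  by rewrite big_ord0 (_ : [set w | _] = setT) ?probability_setT//; apply/seteqP.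
pose E' i (w : T * R) := if i == k then w.2 else E i w.1.
exists _ (T * measurableTypeR R)%type (P \x mu)%E E' => [i|A mA].
  rewrite /E'; case: (i == k); first exact: measurable_snd.
  exact: measurableT_comp.
have -> : [set w | forall i, (i < k.+1)%N -> A i (E' i w)] =
    [set w | forall i, (i < k)%N -> A i (E i w)] `*` A k.
  apply/seteqP; split => -[w x] /=.
    move=> h; split => [i ik|]; last by have := h k (ltnSn k); rewrite /E' eqxx.
    by have := h i (ltnW ik); rewrite /E' ltn_eqF.
  move=> [h Ak] i; rewrite ltnS leq_eqVlt /E' => /orP[/eqP ->|ik].
    by rewrite eqxx.
  by rewrite ltn_eqF//; exact: h.
rewrite [LHS]product_measure1E//.
  by rewrite big_ord_recr/=; congr (_ * _)%E; exact: lawE.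
  2: exact: mA.
have -> : [set w | forall i, (i < k)%N -> A i (E i w)] =
    \bigcap_(i in [set i | (i < k)%N]) (E i @^-1` A i) by [].
by apply: bigcap_measurableType => i _; rewrite -[X in measurable X]setTI; exact: mE.
Qed.

(** * The transition kernel of the set of surviving particles *)

Lemma ffun_neq (I : finType) (T : eqType) (f g : {ffun I -> T}) :
  f != g -> exists i, f i != g i.
Proof.
move=> fg; apply/existsP; apply: contra_neqT fg => /existsPn h; apply/ffunP => i.
by apply/eqP; have := h i; rewrite negbK.
Qed.

Section thinning_kernel.
Context {R : realType} (a : R) (k : nat).
Hypothesis a_ge0 : 0 <= a.
Local Notation state := {ffun 'I_k -> bool}.

(** The transition function of the two-state chain that jumps from [true] to the absorbing state
    [false] at rate [a]. *)
Definition survival_kernel (t : R) (b b' : bool) : R :=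
  if b then (if b' then expR (- (a * t)) else 1 - expR (- (a * t)))
  else (~~ b')%:R.

Definition thinning_kernel (t : R) (f g : state) : R :=
  \prod_i survival_kernel t (f i) (g i).

Lemma survival_kernel_ge0 t b b' : 0 <= t -> 0 <= survival_kernel t b b'.
Proof.
move=> t0; rewrite /survival_kernel; case: b => //; case: b'.
  exact: expR_ge0.
by rewrite subr_ge0 -expR0 ler_expR oppr_le0 mulr_ge0.
Qed.

Lemma survival_kernel_sum t b : \sum_b' survival_kernel t b b' = 1.
Proof.
rewrite big_bool /survival_kernel; case: b => /=.
  by rewrite addrCA subrr addr0.
by rewrite add0r.
Qed.

Lemma survival_kernel0 b b' : survival_kernel 0 b b' = (b == b')%:R.
Proof.
by rewrite /survival_kernel mulr0 oppr0 expR0 subrr; case: b; case: b'.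
Qed.

Lemma survival_kernelD s t b b' :
  survival_kernel (s + t) b b' =
  \sum_b1 survival_kernel s b b1 * survival_kernel t b1 b'.
Proof.
rewrite big_bool /survival_kernel mulrDr opprD expRD.
by case: b; case: b' => /=; ring.
Qed.

Lemma survival_kernel_derivable b b' :
  derivable (fun t => survival_kernel t b b') 0 1.
Proof.
have dE : derivable (fun t => expR (- (a * t))) 0 1 by exact: ex_derive.
rewrite /survival_kernel; case: b; case: b'.
- exact: dE.
- exact: (derivableB (derivable_cst (1 : R) _ _) dE).
- exact: derivable_cst.
- exact: derivable_cst.
Qed.

Lemma thinning_kernel_ge0 t f g : 0 <= t -> 0 <= thinning_kernel t f g.
Proof. by move=> t0; apply: prodr_ge0 => i _; exact: survival_kernel_ge0. Qed.

Lemma thinning_kernel_sum t f : \sum_g thinning_kernel t f g = 1.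
Proof.
rewrite /thinning_kernel -(bigA_distr_bigA (fun i => survival_kernel t (f i))).
by rewrite big1// => i _; exact: survival_kernel_sum.
Qed.

Lemma thinning_kernel0 f g : thinning_kernel 0 f g = (f == g)%:R.
Proof.
rewrite /thinning_kernel; under eq_bigr do rewrite survival_kernel0.
have [<-|fg] := eqVneq f g; first by rewrite big1// => i _; rewrite eqxx.
have [i fgi] := ffun_neq fg.
by rewrite (bigD1 i)//= (negbTE fgi) mul0r.
Qed.

Lemma thinning_kernelD s t f h :
  thinning_kernel (s + t) f h =
  \sum_g thinning_kernel s f g * thinning_kernel t g h.
Proof.
rewrite /thinning_kernel; under eq_bigr do rewrite survival_kernelD.
(* Distributivity turns the product over particles of sums over intermediate bits into a sum over
   intermediate states. *)
rewrite (bigA_distr_bigA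
  (fun i b => survival_kernel s (f i) b * survival_kernel t b (h i))).
by apply: eq_bigr => g _; rewrite big_split.
Qed.

Lemma thinning_kernel_derivable f g :
  derivable (fun t => thinning_kernel t f g) 0 1.
Proof.
rewrite /thinning_kernel; elim: (index_enum _) => [|i r IH].
  rewrite (_ : (fun t => _) = cst 1); first exact: derivable_cst.
  by apply/funext => t; rewrite big_nil.
rewrite (_ : (fun t => _) = (fun t => survival_kernel t (f i) (g i)) *
  (fun t => \prod_(j <- r) survival_kernel t (f j) (g j))).
  by apply: derivableM; [exact: survival_kernel_derivable|exact: IH].
by apply/funext => t; rewrite big_cons.
Qed.

(** The limits are left implicit: the sub-intensity matrix will be defined from them, so they are
    never computed. *)
Lemma thinning_kernel_cvg f g : exists l : R,
  (thinning_kernel h f g - (f == g)%:R) / h @[h --> 0^'+] --> l.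
Proof.
have /cvg_ex[l dl] := @thinning_kernel_derivable f g.
exists l; apply: cvg_dnbhs_at_right.
apply: cvg_trans dl; apply: near_eq_cvg; near=> h.
by rewrite /= addr0 /GRing.scale/= mulr1 thinning_kernel0 mulrC.
Unshelve. all: by end_near. Qed.

(** A dead particle never revives, so the factor of particle [i] vanishes. This is what excludes
    returns to a state once left. *)
Lemma thinning_kernel_stuck t (f g : state) i : ~~ f i -> g i -> thinning_kernel t f g = 0.
Proof.
move=> fi gi; rewrite /thinning_kernel (bigD1 i)//= /survival_kernel.
by rewrite (negbTE fi) gi mul0r.
Qed.

Lemma thinning_kernel_dead t (g : state) :
  thinning_kernel t [ffun => false] g = (g == [ffun => false])%:R.
Proof.
have [->|gF] := eqVneq g [ffun => false].
  by rewrite /thinning_kernel big1// => i _; rewrite !ffunE.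
have [i gi] := ffun_neq gF; rewrite (@thinning_kernel_stuck _ _ _ i) ?ffunE//.
by move: gi; rewrite ffunE; case: (g i).
Qed.

(** Some particle is alive in [f] and has to survive, which contributes the factor
    [expR (- (a * t))]; the other factors are at most 1. *)
Lemma thinning_kernel_diag_le t f : 0 <= t -> f != [ffun => false] ->
  thinning_kernel t f f <= expR (- (a * t)).
Proof.
move=> t0 /ffun_neq[i]; rewrite ffunE eqbF_neg negbK => fi.
rewrite /thinning_kernel (bigD1 i)//= {1}/survival_kernel fi.
rewrite ler_piMr ?expR_ge0//; apply: prodr_ile1 => j _.
rewrite survival_kernel_ge0//= /survival_kernel; case: (f j) => //.
by rewrite -expR0 ler_expR oppr_le0 mulr_ge0.
Qed.

End thinning_kernel.

(** * Markov jump processes on a finite set *)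

(** [T] is the transient block of the right derivative [D] of [Pt] at 0. Off the diagonal [D] is a
    limit of nonnegative quotients, its rows sum to 0 because those of [Pt] sum to 1, and its
    absorbing row is 0. Hence the exit column is minus the row sums of [T], as [full_intensity]
    prescribes. *)
Lemma transition_semigroup_absorbing (R : realType) (p : nat)
    (Pt : R -> 'M[R]_(p + 1)) :
  (forall t i j, 0 <= t -> 0 <= Pt t i j) ->
  (forall t i, 0 <= t -> \sum_j Pt t i j = 1) ->
  Pt 0 = 1%:M ->
  (forall s t, 0 <= s -> 0 <= t -> Pt (s + t) = Pt s *m Pt t) ->
  (forall i j, exists l : R,
    (Pt h i j - (1%:M : 'M[R]_(p + 1)) i j) / h @[h --> 0^'+] --> l) ->
  (forall t j, 0 <= t ->
    Pt t (absorbing_state p) j = (absorbing_state p == j)%:R) ->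
  exists2 T : 'M[R]_p, sub_intensity T &
    transition_semigroup (full_intensity T) Pt.
Proof.
move=> ge0 sum1 id0 CK dPt abs.
have [D' D'E] := choice (fun ij : 'I_(p + 1) * 'I_(p + 1) => dPt ij.1 ij.2).
pose D i j := D' (i, j).
have DE i j : (Pt h i j - (1%:M : 'M[R]_(p + 1)) i j) / h @[h --> 0^'+] --> D i j.
  exact: (D'E (i, j)).
have D_ge0 i j : i != j -> 0 <= D i j.
  move=> ij; apply: (cvgr_to_ge (DE i j)); near=> h.
  by rewrite mxE (negbTE ij) subr0 divr_ge0// ge0.
have D_sum i : \sum_j D i j = 0.
  have sumD : (\sum_j (Pt h i j - (1%:M : 'M[R]_(p + 1)) i j) / h) @[h --> 0^'+] -->
      \sum_j D i j.
    by apply: cvg_big => //; exact: add_continuous.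
  apply: (cvg_unique _ sumD) => //.
  apply: cvg_near_cst; near=> h.
  rewrite -mulr_suml sumrB sum1// (bigD1 i)//= mxE eqxx big1 ?addr0 ?subrr ?mul0r//.
  by move=> j ji; rewrite mxE eq_sym (negbTE ji).
have D_abs j : D (absorbing_state p) j = 0.
  apply: (cvg_unique _ (DE _ _)) => //.
  apply: cvg_near_cst; near=> h.
  by rewrite abs// mxE subrr mul0r.
pose T : 'M[R]_p := \matrix_(i, j) D (lshift 1 i) (lshift 1 j).
have T_sum i : \sum_j T i j = - D (lshift 1 i) (absorbing_state p).
  apply/eqP; rewrite -addr_eq0; apply/eqP.
  have := D_sum (lshift 1 i); rewrite big_split_ord/= big_ord1.
  by under [X in _ -> X + _ = _]eq_bigr do rewrite mxE.
have full i j : full_intensity T i j = D i j.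
  rewrite /full_intensity; case: (split_ordP i) => i' ->; last first.
    rewrite (ord1 i') D_abs; case: (split_ordP j) => j' ->.
      by rewrite block_mxEdl mxE.
    by rewrite block_mxEdr mxE.
  case: (split_ordP j) => j' ->; first by rewrite block_mxEul mxE.
  rewrite block_mxEur !mxE (ord1 j') -[RHS]opprK -T_sum; congr (- _).
  by apply: eq_bigr => j'' _; rewrite !mxE mulr1.
exists T; last first.
  by split => // i j; rewrite full.
split => [i j ij|i]; first by rewrite mxE D_ge0//; apply: contra_neq ij => /lshift_inj.
by rewrite T_sum oppr_le0 D_ge0// eq_lrshift.
Unshelve. all: by end_near. Qed.

Lemma ae_forall_countable (R : realType) d (T : measurableType d)
    (P : probability T R) (I : countType) (Q : I -> T -> Prop) :
  (forall i, {ae P, forall w, Q i w}) -> {ae P, forall w, forall i, Q i w}.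
Proof.
move=> PQ.
have PQn n : {ae P, forall w, if unpickle n is Some i then Q i w else True}.
  by case: (unpickle n) => [i|]; [exact: PQ|exact: aeW].
by apply: filterS (ae_foralln PQn) => w h i; have := h (pickle i); rewrite pickleK.
Qed.

Lemma ae_notin (R : realType) d (T : measurableType d) (P : probability T R)
    (A : set T) :
  measurable A -> P A = 0%E -> {ae P, forall w, ~ A w}.
Proof. by move=> mA PA; exists A; split => // w /= /contrapT. Qed.

Lemma mjp_two_times (R : realType) d (T : measurableType d)
    (P : probability T R) (n : nat) (J : R -> T -> 'I_n) (alpha : 'rV[R]_n)
    (Pt : R -> 'M[R]_n) (s t : R) (j1 j2 : 'I_n) :
  markov_jump_process P J alpha Pt -> 0 <= s -> s < t ->
  P ([set w | J s w = j1] `&` [set w | J t w = j2]) =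
  (P [set w | J s w = j1] * (Pt (t - s) j1 j2)%:E)%E.
Proof.
move=> JM s0 st.
pose tt m := if m is 0 then s else t; pose ii m := if m is 0 then j1 else j2.
have le0 l : (l <= 0)%N -> tt l < tt l.+1 by case: l.
have := @mjp_markov _ _ _ _ _ _ _ _ JM 0 tt ii s0 le0.
have -> : [set w | forall l : nat, (l <= 0)%N -> J (tt l) w = ii l] =
    [set w | J s w = j1].
  by apply/seteqP; split => w /= => [/(_ 0)->//|h [|]].
have -> // : [set w | forall l : nat, (l <= 1)%N -> J (tt l) w = ii l] =
    [set w | J s w = j1] `&` [set w | J t w = j2].
apply/seteqP; split => w /=; first by move=> h; split; [exact: (h 0)|exact: (h 1)].
by move=> [h1 h2] [|[|]].
Qed.

(* By right continuity, it is enough to exclude returns to i at rational times,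
   that is, countably many null events. *)
Lemma transient_state_criterion (R : realType) (n : nat) (Pt : R -> 'M[R]_n)
    (i : 'I_n) :
  (forall s t j, 0 <= s -> 0 <= t -> j != i -> Pt s i j = 0 \/ Pt t j i = 0) ->
  Pt m%:R i i @[m --> \oo] --> (0 : R) ->
  transient_state Pt i.
Proof.
move=> noreturn leave d T P J JM.
have mJ t j : 0 <= t -> measurable [set w | J t w = j].
  exact: (mjp_measurable JM).
have init1 : P [set w | J 0 w = i] = 1%E.
  by rewrite (mjp_init JM) mxE !eqxx.
have init0 : P (~` [set w | J 0 w = i]) = 0%E.
  by rewrite probability_setC ?init1 ?subee//; exact: mJ.
(* The process starts in [i] almost surely, so intersecting with [J 0 w = i] loses only a null
   set. *)
have law t j : 0 < t -> (P [set w | J t w = j] <= (Pt t i j)%:E)%E.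
  move=> t0.
  have := mjp_two_times i j JM (lexx 0) t0; rewrite init1 mul1e subr0 => <-.
  rewrite -[leRHS]adde0 -init0.
  have mJ0 := mJ 0 i (lexx 0); have mJt := mJ t j (ltW t0).
  apply: (@le_trans _ _ (P (([set w | J 0 w = i] `&` [set w | J t w = j]) `|`
      ~` [set w | J 0 w = i]))).
    apply: le_measure; rewrite ?inE//.
      by apply: measurableU; [exact: measurableI|exact: measurableC].
    by move=> w /= Jt; have [Ji|Ji] := pselect (J 0 w = i); [left|right].
  by apply: measureU2; [exact: measurableI|exact: measurableC].
have noreturn0 s t j : 0 < s -> s < t -> j != i ->
    P ([set w | J s w = j] `&` [set w | J t w = i]) = 0%E.
  move=> s0 st ji; rewrite (mjp_two_times _ _ JM (ltW s0) st).
  have ts0 : 0 <= t - s by rewrite subr_ge0 ltW.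
  have [sij|->] := noreturn s (t - s) j (ltW s0) ts0 ji; last first.
    by rewrite mule0.
  suff -> : P [set w | J s w = j] = 0%E by rewrite mul0e.
  by apply/eqP; rewrite eq_le measure_ge0 andbT (le_trans (law _ _ s0))// sij.
(* For each [m], being in [i] at all positive integer times has probability at most [Pt m.+1 i i],
   which tends to 0. *)
have leaves : {ae P, forall w, exists m : nat, J m.+1%:R w <> i}.
  have mI : measurable (\bigcap_m [set w | J m.+1%:R w = i]).
    by apply: bigcap_measurableType => m _; exact: mJ.
  have PI : P (\bigcap_m [set w | J m.+1%:R w = i]) = 0%E.
    apply/eqP; rewrite eq_le measure_ge0 andbT.
    rewrite -[leLHS]fineK ?fin_num_measure// lee_fin.
    have leave1 : Pt m.+1%:R i i @[m --> \oo] --> (0 : R) by move: leave; rewrite -cvg_shiftS.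
    apply: (cvgr_to_ge leave1); near=> m.
    rewrite -lee_fin fineK ?fin_num_measure//; apply: le_trans (law _ _ _) => //.
    by apply: le_measure; rewrite ?inE//; [exact: mJ|exact: bigcap_inf].
  have := ae_notin mI PI; apply: filterS => w /= h.
  by apply: contrapT => /forallNP h'; apply: h => m _; apply: contrapT => /(h' m).
(* The countable family of null events: being in some [j] other than [i] at an integer time and back
   in [i] at a later rational time. *)
have stays_out : {ae P, forall w, forall mqj : nat * rat * 'I_n,
    mqj.1.1.+1%:R < ratr mqj.1.2 :> R -> J mqj.1.1.+1%:R w = mqj.2 ->
    mqj.2 != i -> J (ratr mqj.1.2) w <> i}.
  apply: ae_forall_countable => -[[m q] j] /=.
  have [mq|mq] := ltP (m.+1%:R : R) (ratr q); last exact: aeW.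
  have [->|ji] := eqVneq j i; first exact: aeW.
  apply: filterS (ae_notin _ (noreturn0 _ _ _ _ mq ji)) => //.
  + by move=> w /= h _ Jm _ Jq; exact: h.
  + by apply: measurableI; apply: mJ => //; rewrite (le_trans _ (ltW mq)).
apply: filterS2 leaves stays_out => w [m Jm] out.
(* Taking [m.+2] makes [t] strictly later than [m.+1], the time at which the process is known to be
   outside [i]. *)
exists (m.+2)%:R => t mt Jt.
have m0 : (0 : R) <= t by rewrite (le_trans _ mt).
have mt' : m.+1%:R < t by rewrite (lt_le_trans _ mt)// ltr_nat.
(* A visit to [i] at time [t] lasts for a short interval to the right, which contains a rational
   time. *)
have := mjp_right_continuous JM w m0 => -[e /= e0 near_t].
have te : t < t + e by rewrite ltrDl.
have [q qt] := rat_in_itvoo te.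
move: qt; rewrite in_itv/= => /andP[tq qe].
have Jq : J (ratr q) w = i.
  rewrite near_t//=; first by rewrite /ball/= ler0_norm; lra.
apply: (out (m, q, J m.+1%:R w)) => //=; last exact/eqP.
exact: lt_trans tq.
Unshelve. all: by end_near. Qed.

(** The enumeration of [S] puts [x0] at an arbitrary rank; a transposition then moves it to the last
    index, the one reserved for absorption. *)
Lemma absorbing_encoding (S : finType) (x0 : S) :
  exists p (e : S -> 'I_(p + 1)) (e' : 'I_(p + 1) -> S),
    [/\ cancel e e', cancel e' e, e x0 = absorbing_state p & #|S| = p + 1]%N.
Proof.
have cardS : #|S| = (#|S|.-1 + 1)%N.
  by rewrite addn1 prednK//; apply/card_gt0P; exists x0.
pose c x : 'I_(#|S|.-1 + 1) := cast_ord cardS (enum_rank x).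
pose c' i : S := enum_val (cast_ord (esym cardS) i).
have cK : cancel c c' by move=> x; rewrite /c /c' cast_ordK enum_rankK.
have c'K : cancel c' c by move=> x; rewrite /c /c' enum_valK cast_ordKV.
pose r := tperm (c x0) (absorbing_state _).
exists #|S|.-1, (r \o c), (c' \o r); split => //=.
- by move=> x /=; rewrite tpermK cK.
- by move=> x /=; rewrite c'K tpermK.
- by rewrite tpermL.
Qed.

Lemma cvg_expR_decay (R : realType) (a : R) : 0 < a ->
  expR (- (a * n%:R)) @[n --> \oo] --> (0 : R).
Proof.
move=> a0; rewrite (_ : (fun n : nat => _) = (fun n => expR (- a) ^+ n)).
  by apply: cvg_expr; rewrite ger0_norm ?expR_ge0// expR_lt1 oppr_lt0.
by apply/funext => n; rewrite -expRM_natl mulrN mulrC.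
Qed.

(** * The process of surviving particles *)

Lemma iid_law_ord (R : realType) (mu : probability (measurableTypeR R) R)
    (k : nat) (M : iid_model mu k) (A : 'I_k -> set R) :
  (forall i, measurable (A i)) ->
  iid_prob M [set w | forall i : 'I_k, A i (iid_fun M i w)] =
  (\prod_(i < k) mu (A i))%E.
Proof.
move=> mA; pose A' i := if insub i is Some j then A j else setT.
have A'E (i : 'I_k) : A' i = A i by rewrite /A' valK.
have mA' i : measurable (A' i) by rewrite /A'; case: insub.
under [RHS]eq_bigr do rewrite -A'E.
rewrite -(iid_law M A' mA'); congr (iid_prob M _); apply/seteqP; split => w /= h i.
  by move=> ik; have := h (Ordinal ik); rewrite -A'E.
by rewrite -A'E; exact: h.
Qed.

(** * One particle observed at finitely many times *)

Section survival_path.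
Context {R : realType} (a : R) (mu : probability (measurableTypeR R) R).
Hypothesis muE : forall t, 0 <= t -> mu `]t, +oo[%classic = (expR (- (a * t)))%:E.

(** The lifetimes compatible with the observations [s] at the times [t 0, ..., t n], for a particle
    that is present from the start or not according to [b]. *)
Definition survival_path (b : bool) (t : nat -> R) (s : nat -> bool) (n : nat) :
    set R :=
  [set x | forall l, (l <= n)%N -> b && (t l < x) = s l].

Lemma survival_pathS b t s n :
  survival_path b t s n.+1 =
  survival_path b t s n `&` [set x | b && (t n.+1 < x) = s n.+1].
Proof.
apply/seteqP; split => x /=.
  by move=> h; split; [move=> l ln; apply: h; exact: leqW|exact: h].
by move=> [h1 h2] l; rewrite leq_eqVlt => /orP[/eqP->//|]; exact: h1.
Qed.

Lemma measurable_survival_path b t s n :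
  measurable (survival_path b t s n : set (measurableTypeR R)).
Proof.
have m1 r c : measurable ([set x | b && (r < x) = c] : set (measurableTypeR R)).
  have mr : measurable (`]r, +oo[%classic : set (measurableTypeR R)) by [].
  have -> : [set x | b && (r < x) = c] = if b then
      if c then `]r, +oo[%classic else ~` `]r, +oo[%classic
      else if c then set0 else setT.
    by apply/seteqP; split => x; case: b; case: c => //=; rewrite in_itv/= andbT //;
      [move=> -> | move=> /negP/negbTE].
  by case: b; case: c => //; exact: measurableC.
elim: n => [|n IH]; last by rewrite survival_pathS; exact: measurableI.
rewrite (_ : survival_path _ _ _ _ = [set x | b && (t 0%N < x) = s 0%N])//.
by apply/seteqP; split => x /= => [/(_ 0%N)->//|h [|]].
Qed.

(** A particle alive at [t n] was alive at all earlier times, so the observations are either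
    contradictory or equivalent to the last one. *)
Lemma survival_path_alive b t (s : nat -> bool) n : (forall l, (l <= n)%N -> t l <= t n) ->
  s n -> survival_path b t s n = set0 \/ survival_path b t s n = `]t n, +oo[%classic.
Proof.
move=> tn sn; have [[x0 hx0]|h] := pselect (survival_path b t s n !=set0); last first.
  by left; apply/seteqP; split => // x hx; apply: h; exists x.
right; have /andP[b1 tx0] : b && (t n < x0) by rewrite hx0.
apply/seteqP; split => x /=; rewrite in_itv/= andbT.
  by move=> /(_ n (leqnn n)); rewrite sn => /andP[].
move=> tx l ln; rewrite -(hx0 l ln) b1/=.
by rewrite (le_lt_trans (tn l ln) tx) (le_lt_trans (tn l ln) tx0).
Qed.

(** This is the memorylessness of the exponential law, the past being reduced to the last
    observation. *)
Lemma survival_path_markov b t s n :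
  0 <= t 0%N -> (forall l, (l <= n)%N -> t l < t l.+1) ->
  mu (survival_path b t s n.+1) =
  (mu (survival_path b t s n) *
   (survival_kernel a (t n.+1 - t n) (s n) (s n.+1))%:E)%E.
Proof.
move=> t0 tS.
have tn l : (l <= n)%N -> t l <= t n.
  elim: n tS => [|n IH] tS; first by rewrite leqn0 => /eqP->.
  rewrite leq_eqVlt => /orP[/eqP->//|ln]; apply: le_trans (ltW (tS n (leqnSn n))).
  by apply: IH => // l' l'n; apply: tS; exact: leqW.
have tn0 : 0 <= t n by rewrite (le_trans t0)// tn.
have tnn : t n < t n.+1 by exact: tS.
(* If the particle is seen dead at [t n], it is absent or has lifetime at most [t n], so its next
   state is certain. *)
rewrite survival_pathS; case sn : (s n); last first.
  rewrite /survival_kernel; case sn1 : (s n.+1) => /=.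
    rewrite mule0 (_ : _ `&` _ = set0) ?measure0//.
    apply/seteqP; split => x //= -[/(_ n (leqnn n))].
    by rewrite sn; case: b => //= tx tx'; rewrite (lt_trans tnn tx') in tx.
  rewrite mule1; congr (mu _); apply/seteqP; split => x /= => [[]//|h]; split => //.
  have := h n (leqnn n); rewrite sn; case: (b) => //= /negbT; rewrite -leNgt => xt.
  by apply/negbTE; rewrite -leNgt (le_trans xt)// ltW.
have [->|pE] := survival_path_alive b tn sn; first by rewrite set0I measure0 mul0e.
have b1 : b.
  have : survival_path b t s n (t n + 1) by rewrite pE/= in_itv/= andbT ltrDl.
  by move=> /(_ n (leqnn n)); rewrite sn => /andP[].
rewrite pE b1/= (muE tn0).
have tn10 : 0 <= t n.+1 by rewrite (le_trans tn0)// ltW.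
have setE : `]t n, +oo[%classic `&` `]t n.+1, +oo[%classic = `]t n.+1, +oo[%classic.
  apply/setIidPr; apply: subset_itvr; by rewrite bnd_simp ltW.
case: (s n.+1) => /=.
  rewrite (_ : _ `&` _ = `]t n.+1, +oo[%classic); last first.
    by rewrite -setE; congr (_ `&` _); apply/seteqP; split => x /=; rewrite in_itv/= andbT.
  rewrite muE// -EFinM -expRD; congr (expR _)%:E; ring.
rewrite (_ : _ `&` _ = `]t n, +oo[%classic `\` `]t n.+1, +oo[%classic); last first.
  rewrite setDE; congr (_ `&` _); apply/seteqP; split => x /=; rewrite in_itv/= andbT.
    by move=> ->.
  by move=> /negP/negbTE.
rewrite measureD//; last by rewrite -ge0_fin_numE// fin_num_measure.
rewrite [X in (X - _)%E]muE// [X in (_ - X)%E](_ : _ = (expR (- (a * t n.+1)))%:E).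
  2: by rewrite setE; exact: muE.
rewrite -EFinB -EFinM mulrBr mulr1 -expRD.
by congr (_ - expR _)%:E; ring.
Qed.

End survival_path.

(** * The set of living particles in a random environment, and its absorption time *)

Section thinned_process.
Context {R : realType} (a : R) (mu : probability (measurableTypeR R) R).
Hypothesis a_gt0 : 0 < a.
Hypothesis muE : forall t, 0 <= t -> mu `]t, +oo[%classic = (expR (- (a * t)))%:E.
Context (k : nat) (M : iid_model mu k).
Context d (S : measurableType d) (P : probability S R) (act : nat -> S -> bool).
Hypothesis act_measurable : forall i, measurable [set z | act i z].
Local Notation state := {ffun 'I_k -> bool}.
Local Notation PM := (P \x iid_prob M)%E.

(** [act i z] tells whether particle [i] is present in the environment [z]. The strict inequality
    makes the paths right-continuous. *)
Definition alive (t : R) (w : S * iid_space M) : state :=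
  [ffun i : 'I_k => act i w.1 && (t < iid_fun M i w.2)].

Lemma measurable_alive t f : measurable [set w | alive t w = f].
Proof.
have -> : [set w | alive t w = f] =
    \bigcap_(i in [set: 'I_k]) [set w | act i w.1 && (t < iid_fun M i w.2) = f i].
  apply/seteqP; split => w /= => [<- i _ /=|h]; first by rewrite ffunE.
  by apply/ffunP => i; rewrite ffunE; exact: h.
apply: fin_bigcap_measurable => [|i _]; first exact: finite_finset.
have mA : measurable [set w : S * iid_space M | act i w.1].
  rewrite -[X in measurable X]setTI.
  exact: (@measurable_fst _ _ S (iid_space M) measurableT _ (act_measurable i)).
have mE : measurable [set w : S * iid_space M | t < iid_fun M i w.2].
  have mEs : measurable_fun [set: S * iid_space M] (fun w => iid_fun M i w.2).
    exact: measurableT_comp (iid_measurable M i) measurable_snd.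
  have -> : [set w : S * iid_space M | t < iid_fun M i w.2] =
      setT `&` (fun w => iid_fun M i w.2) @^-1` `]t, +oo[.
    by apply/seteqP; split => w /=; rewrite in_itv/= andbT => // -[].
  exact: mEs.
have mAE := measurableI _ _ mA mE.
case: (f i).
  rewrite (_ : [set w | _] = [set w | act i w.1] `&` [set w | t < iid_fun M i w.2])//.
  by apply/seteqP; split => w /= => [/andP[]|[-> ->]].
rewrite (_ : [set w | _] =
  ~` ([set w | act i w.1] `&` [set w | t < iid_fun M i w.2])); first exact: measurableC.
apply/seteqP; split => w /=; first by move=> + [h1 h2]; rewrite h1 h2.
by move=> h; apply/negbTE/negP => /andP.
Qed.

Definition alive_path (t : nat -> R) (f : nat -> state) (n : nat) :
    set (S * iid_space M) :=
  [set w | forall l, (l <= n)%N -> alive (t l) w = f l].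

Lemma measurable_alive_path t f n : measurable (alive_path t f n).
Proof.
rewrite (_ : alive_path _ _ _ =
  \bigcap_(l in [set l | (l <= n)%N]) [set w | alive (t l) w = f l])//.
by apply: bigcap_measurableType => l _; exact: measurable_alive.
Qed.

Lemma xsection_alive_path t f n z :
  iid_prob M (xsection (alive_path t f n) z) =
  (\prod_(i < k) mu (survival_path (act i z) t (fun l => f l i) n))%E.
Proof.
pose A (i : 'I_k) := survival_path (act i z) t (fun l => f l i) n.
rewrite -(iid_law_ord M (A := A)).
  congr (iid_prob M _); apply/seteqP; split => e; rewrite /xsection/= inE/=.
    by move=> h i l ln; have := h l ln => /ffunP/(_ i); rewrite ffunE.
  by move=> h l ln; apply/ffunP => i; rewrite ffunE; exact: h.
by move=> i; exact: measurable_survival_path.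
Qed.

(* Given z, the particles are independent, and the resulting kernel does not
   depend on z: it comes out of the integral over z. *)
Lemma alive_path_markov t f n :
  0 <= t 0%N -> (forall l, (l <= n)%N -> t l < t l.+1) ->
  PM (alive_path t f n.+1) =
  (PM (alive_path t f n) *
   (thinning_kernel a (t n.+1 - t n) (f n) (f n.+1))%:E)%E.
Proof.
move=> t0 tS; have tnn : 0 <= t n.+1 - t n by rewrite subr_ge0 ltW// tS.
rewrite /product_measure1 -ge0_integralZr//; first last.
- by rewrite lee_fin thinning_kernel_ge0// ltW.
- apply: measurable_fun_xsection; exact: measurable_alive_path.
apply: eq_integral => z _ /=.
rewrite !xsection_alive_path /thinning_kernel -prodEFin -big_split/=.
by apply: eq_bigr => i _; exact: survival_path_markov.
Qed.

Lemma xsection_dead t z : 0 <= t ->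
  iid_prob M (xsection [set w | alive t w = [ffun => false]] z) =
  (\prod_(i < k) (if act i z then 1 - expR (- (a * t)) else 1))%:E.
Proof.
move=> t0.
(* A single observation is a path with [n = 0], to which the product formula for sections
   applies. *)
have -> : [set w | alive t w = [ffun => false]] =
    alive_path (fun=> t) (fun=> [ffun => false]) 0.
  by apply/seteqP; split => w /=; [move=> <- l _|move=> /(_ 0%N (leqnn _))].
rewrite xsection_alive_path -prodEFin; apply: eq_bigr => i _.
have -> : survival_path (act i z) (fun=> t) (fun=> [ffun => false] i) 0 =
    if act i z then ~` `]t, +oo[%classic else setT.
  rewrite /survival_path; case: (act i z); apply/seteqP; split => x //=.
  - by move=> /(_ 0%N (leqnn _)); rewrite ffunE/= in_itv/= andbT => ->.
  - by rewrite in_itv/= andbT => /negP/negbTE h l _; rewrite ffunE.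
  - by move=> _ l _; rewrite ffunE.
case: (act i z); last by rewrite probability_setT.
by rewrite probability_setC// muE.
Qed.

Hypothesis k_gt0 : (0 < k)%N.
Hypothesis act0 : forall z, act 0 z.

(** Particle 0 is always present and its lifetime is almost surely positive: its factor is
    [1 - expR 0 = 0]. Hence the initial law puts no mass on the absorbing state. *)
Lemma alive_initially : PM [set w | alive 0 w = [ffun => false]] = 0%E.
Proof.
apply: integral0_eq => z _ /=; rewrite xsection_dead//.
by rewrite (bigD1 (Ordinal k_gt0))//= act0 mulr0 oppr0 expR0 subrr mul0r.
Qed.

(** The default value 0 makes the maximum nonnegative at every outcome, including those where a
    lifetime is negative; it matches the restriction of [absorption_time] to nonnegative times. *)
Definition last_death (w : S * iid_space M) : R :=
  \big[Num.max/0]_(i < k | act i w.1) iid_fun M i w.2.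

Lemma last_death_le w t :
  (last_death w <= t) <-> 0 <= t /\ alive t w = [ffun => false].
Proof.
rewrite /last_death; split.
  move=> /bigmax_leP[t0 h]; split => //; apply/ffunP => i; rewrite !ffunE.
  by apply/negbTE/negP => /andP[/(h i)]; rewrite leNgt => /negbTE ->.
move=> [t0 /ffunP h]; apply/bigmax_leP; split => // i acti.
by have := h i; rewrite !ffunE acti/= => /negbT; rewrite -leNgt.
Qed.

Lemma last_death_ge0 w : 0 <= last_death w.
Proof. exact: bigmax_ge_id. Qed.

Lemma measurable_last_death : measurable_fun setT last_death.
Proof.
apply: (measurability _ (RGenOInfty.measurableE R)) => _ [_ [x ->] <-].
rewrite setTI (_ : _ @^-1` _ = ~` [set w | 0 <= x /\ alive x w = [ffun => false]]).
  apply: measurableC; have [x0|x0] := leP 0 x.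
    rewrite (_ : [set w | _] = [set w | alive x w = [ffun => false]]).
      exact: measurable_alive.
    by apply/seteqP; split => w /= [].
  by rewrite (_ : [set w | _] = set0)//; apply/seteqP; split => w //= [].
apply/seteqP; split => w /=; rewrite in_itv/= andbT ltNge.
  by move=> /negP h /last_death_le.
by move=> h; apply/negP => /last_death_le.
Qed.

(** The times [t >= 0] at which all particles are dead form the closed half-line from
    [last_death w], so the infimum is attained there, for every outcome. *)
Lemma absorption_time_last_death (p : nat)
    (e : state -> 'I_(p + 1)) w :
  injective e -> e [ffun => false] = absorbing_state p ->
  absorption_time (fun t w => e (alive t w)) w = (last_death w)%:E.
Proof.
move=> inje edead; apply/eqP; rewrite eq_le; apply/andP; split.
  apply: ereal_inf_lbound; exists (last_death w) => //=.
  by have /last_death_le[h ->] := lexx (last_death w).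
apply: le_ereal_inf_tmp => _ [t [t0 Jt] <-]; rewrite lee_fin.
by apply/last_death_le; split => //; apply: inje; rewrite edead.
Qed.

Lemma alive_right_continuous w t : \forall s \near t^'+, alive s w = alive t w.
Proof.
suff : \forall s \near t^'+, forall i : 'I_k,
    (s < iid_fun M i w.2) = (t < iid_fun M i w.2).
  by apply: filterS => s h; apply/ffunP => i; rewrite !ffunE h.
apply: filter_forall => i; have [tE|Et] := ltP t (iid_fun M i w.2).
  by near=> s; near: s; exact: nbhs_right_lt.
near=> s; apply/negbTE; rewrite -leNgt (le_trans Et)//.
Unshelve. all: by end_near. Qed.

(** The left limit at [t] still counts the particles that die exactly at [t], whence the weak
    inequality. *)
Lemma alive_left_limit w t : exists f, \forall s \near t^'-, alive s w = f.
Proof.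
exists [ffun i : 'I_k => act i w.1 && (t <= iid_fun M i w.2)].
suff : \forall s \near t^'-, forall i : 'I_k,
    (s < iid_fun M i w.2) = (t <= iid_fun M i w.2).
  by apply: filterS => s h; apply/ffunP => i; rewrite !ffunE h.
apply: filter_forall => i; have [tE|Et] := leP t (iid_fun M i w.2).
  by near=> s; rewrite (lt_le_trans _ tE).
near=> s; apply/negbTE; rewrite -leNgt ltW//; near: s; exact: nbhs_left_gt.
Unshelve. all: by end_near. Qed.

Lemma probability_fibers (n : nat) d' (T : measurableType d')
    (Q : probability T R) (X : T -> 'I_n) :
  (forall i, measurable [set w | X w = i]) ->
  (\sum_i Q [set w | X w = i] = 1)%E.
Proof.
move=> mX; rewrite -measure_bigsetU_ord//.
  rewrite -[RHS](probability_setT Q); congr (Q _); rewrite -bigcup_seq.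
  by apply/seteqP; split => // w _; exists (X w) => //=; rewrite mem_index_enum.
by move=> i j _ _ [w [/= <- <-]].
Qed.

(** The process of living particles is transported to ['I_(p + 1)] with the empty set as last state.
    The environment affects only the initial law [pi], while [Pt] comes from the thinning kernel
    alone. *)
Lemma phase_type_last_death d' (T : measurableType d') (Q : probability T R)
    (tau : {RV PM >-> R}) (Y : {RV Q >-> R}) :
  (forall w, tau w = last_death w) -> eq_in_law tau Y -> phase_type Y.
Proof.
move=> tauE tauY.
pose dead : state := [ffun => false].
have [p [e [e' [eK e'K edead cardS]]]] := absorbing_encoding dead.
have e'dead : e' (absorbing_state p) = dead by rewrite -edead eK.
have e'_inj := can_inj e'K; have e_inj := can_inj eK.
pose Pt t : 'M[R]_(p + 1) := \matrix_(i, j) thinning_kernel a t (e' i) (e' j).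
pose J t w := e (alive t w).
have JE t i : [set w | J t w = i] = [set w | alive t w = e' i].
  by apply/seteqP; split => w /=; rewrite /J; [move=> <-; rewrite eK|move=> ->].
have mJ t i : measurable [set w | J t w = i].
  by rewrite JE; exact: measurable_alive.
have a_ge0 := ltW a_gt0.
have sum_e' (F : state -> R) : \sum_j F (e' j) = \sum_g F g.
  by rewrite [RHS](reindex e')//; apply: onW_bij; exists e.
have [T0 T0sub semi] : exists2 T0 : 'M[R]_p, sub_intensity T0 &
    transition_semigroup (full_intensity T0) Pt.
  apply: transition_semigroup_absorbing.
  - by move=> t i j t0; rewrite mxE thinning_kernel_ge0.
  - move=> t i t0; under eq_bigr do rewrite mxE.
    by rewrite (sum_e' (thinning_kernel a t (e' i))) thinning_kernel_sum.
  - by apply/matrixP => i j; rewrite !mxE thinning_kernel0 (inj_eq e'_inj).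
  - move=> s t _ _; apply/matrixP => i j; rewrite !mxE thinning_kernelD.
    rewrite -sum_e'; by apply: eq_bigr => g _; rewrite !mxE.
  - move=> i j; have [l hl] := thinning_kernel_cvg a (e' i) (e' j).
    exists l; rewrite mxE -(inj_eq e'_inj).
    by apply: cvg_trans hl; apply: near_eq_cvg; near=> h; rewrite mxE.
  - move=> t j t0; rewrite mxE e'dead thinning_kernel_dead -/dead -e'dead.
    by rewrite (inj_eq e'_inj) eq_sym.
(* There are [2 ^ k] states, at least two as [k] is positive, so one remains besides the empty
   set. *)
have p_gt0 : (0 < p)%N.
  have : (1 < #|state|)%N.
    rewrite card_ffun card_bool card_ord -(expn0 2) ltn_exp2l//.
  by rewrite cardS addn1 ltnS.
pose pi : 'rV[R]_p := \row_j fine (PM [set w | J 0 w = lshift 1 j]).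
have init i : PM [set w | J 0 w = i] = (row_mx pi (0 : 'rV_1) ord0 i)%:E.
  case: (split_ordP i) => j ->; last first.
    by rewrite row_mxEr mxE (ord1 j) JE e'dead alive_initially.
  by rewrite row_mxEl mxE fineK//; exact: (fin_num_measure (PM : probability _ R)).
have pi_sum : \sum_i pi ord0 i = 1.
  have sumJ : (\sum_i PM [set w | J 0%R w = i] = 1)%E by exact: probability_fibers.
  apply: EFin_inj; rewrite -[RHS]sumJ; under [RHS]eq_bigr do rewrite init.
  rewrite sumEFin big_split_ord/= big_ord1 row_mxEr mxE addr0.
  by congr EFin; apply: eq_bigr => i _; rewrite row_mxEl.
have JM : markov_jump_process PM J (row_mx pi 0) Pt.
  split => //.
  - move=> n t i t0 tS.
    have := alive_path_markov (fun l => e' (i l)) t0 tS.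
    rewrite mxE /alive_path /J.
    have JE' m : [set w | forall l, (l <= m)%N -> e (alive (t l) w) = i l] =
        [set w | forall l, (l <= m)%N -> alive (t l) w = e' (i l)].
      by apply/seteqP; split => w /= h l lm; [rewrite -h//|rewrite h].
    by rewrite !JE'.
  - by move=> w t _; apply: filterS (alive_right_continuous w t) => s; rewrite /J => ->.
  - move=> w t _; have [f hf] := alive_left_limit w t; exists (e f).
    by apply: filterS hf => s; rewrite /J => ->.
have transient (i : 'I_p) : transient_state Pt (lshift 1 i).
  apply: transient_state_criterion.
    move=> s t j s0 t0 ji; rewrite !mxE.
    (* Two distinct states differ at some particle [l]. The one where [l] is dead cannot lead to the
       one where [l] is alive, so one of the two directions has probability 0. *)
    have [l] := ffun_neq (contra_neq (@e'_inj _ _) ji).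
    case: (boolP (e' j l)) => [jl|jl] il; [left|right].
      by apply: thinning_kernel_stuck jl; case: (e' _ l) il.
    by apply: thinning_kernel_stuck jl _; case: (e' _ l) il.
  apply: (@squeeze_cvgr _ _ _ _ (cst 0) (fun m => expR (- (a * m%:R)))) => //.
  - near=> m; rewrite mxE thinning_kernel_ge0//= thinning_kernel_diag_le//.
    by rewrite -/dead -e'dead (inj_eq e'_inj) eq_lrshift.
  - exact: cvg_cst.
  - exact: cvg_expR_decay.
exists p, pi, T0; split => //.
  split => // i; by rewrite mxE fine_ge0.
exists Pt; split => //; exists _, _, PM, J, tau; split => //.
apply: aeW => w; rewrite tauE absorption_time_last_death//.
Unshelve. all: by end_near. Qed.
End thinned_process.

(** * Concentration of the last death *)

(** The inverse is expressed by a real power of the square; the identity also holds at 0, where both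
    sides are 0. *)
Lemma measurable_inv (R : realType) :
  measurable_fun [set: measurableTypeR R] (GRing.inv : R -> R).
Proof.
rewrite (_ : GRing.inv = fun x : R => x * (x ^+ 2) `^ (-1)); last first.
  apply/funext => x; rewrite powR_inv1 ?sqr_ge0//.
  have [->|x0] := eqVneq x 0; first by rewrite invr0 mul0r.
  by rewrite expr2 invfM mulrA mulfV// mul1r.
apply: measurable_funM => //.
apply: (measurableT_comp (measurable_powR (-1))).
exact: measurable_funX.
Qed.

Lemma product_le (R : realType) d1 d2 (T1 : measurableType d1)
    (T2 : measurableType d2) (P1 : probability T1 R) (P2 : probability T2 R)
    (B : set (T1 * T2)) (m : R) :
  measurable B -> (forall z, P2 (xsection B z) <= m%:E)%E ->
  ((P1 \x P2) B <= m%:E)%E.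
Proof.
move=> mB Bm; apply: (@le_trans _ _ (\int[P1]_z (cst m%:E z))%E).
  apply: ge0_le_integral => //; first exact: measurable_fun_xsection.
  by move=> z _; exact: Bm.
by rewrite integral_cst//= [X in (_ * X)%E]probability_setT mule1.
Qed.

(** The number of indices [i < k] with [i <= V] is the minimum of [k] and the integer part of [V]
    plus one, as 0 is counted. *)
Lemma prod_threshold (R : realType) (u V : R) (k : nat) : 0 <= V ->
  \prod_(i < k) (if i%:R <= V then u else 1) =
  u ^+ minn k (Num.truncn V).+1.
Proof.
move=> V0; elim: k => [|k IH]; first by rewrite big_ord0 min0n.
rewrite big_ord_recr/= IH -truncn_ge_nat//.
have [kV|Vk] := leqP k (Num.truncn V).
  by rewrite (minn_idPl (leqW kV)) (minn_idPl _)// -exprSr.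
by rewrite mulr1 (minn_idPr Vk) (minn_idPr (leqW Vk)).
Qed.

Lemma Bernoulli_lower (R : realType) (q : R) (m : nat) : 0 <= q <= 1 ->
  1 - m%:R * q <= (1 - q) ^+ m.
Proof.
move=> /andP[q0 q1]; elim: m => [|m IH]; first by rewrite mul0r subr0 expr0.
rewrite exprS -natr1; have m0 : (0 : R) <= m%:R by [].
apply: (@le_trans _ _ ((1 - q) * (1 - m%:R * q))); first by nra.
by rewrite ler_wpM2l// subr_ge0.
Qed.

(** The exponent is at least [v], and [1 - q <= expR (- q)]. *)
Lemma threshold_upper (R : realType) (q V v : R) (k : nat) : 0 <= q <= 1 ->
  0 <= V -> v <= V -> v <= k%:R ->
  (1 - q) ^+ minn k (Num.truncn V).+1 <= expR (- (q * v)).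
Proof.
move=> /andP[q0 q1] V0 vV vk; set m := minn _ _.
have vm : v <= m%:R.
  rewrite /m /minn; case: ifP => // _; apply: (le_trans vV).
  by have /andP[_ /ltW] := truncn_itv V0.
apply: (@le_trans _ _ (expR (- q) ^+ m)).
  by rewrite lerXn2r ?nnegrE ?subr_ge0 ?expR_ge0// expR_ge1Dx.
by rewrite -expRM_natl ler_expR mulrN lerN2 mulrC ler_wpM2r.
Qed.

(** The exponent is at most [V + 1], and Bernoulli's inequality applies. *)
Lemma threshold_lower (R : realType) (q V : R) (k : nat) : 0 <= q <= 1 ->
  0 <= V -> 1 - (1 - q) ^+ minn k (Num.truncn V).+1 <= (V + 1) * q.
Proof.
move=> q01 V0; rewrite lerBlDl -lerBlDr; set m := minn _ _.
apply: le_trans (Bernoulli_lower m q01); case/andP: q01 => q0 q1.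
rewrite lerB// ler_wpM2r// (@le_trans _ _ (Num.truncn V).+1%:R)//.
  by rewrite ler_nat geq_minr.
by rewrite -natr1 lerD2r truncn_le.
Qed.

(** * A number of particles tuned so that the last death falls near [W] *)

Section threshold_process.
Context {R : realType} (a : R) (mu : probability (measurableTypeR R) R).
Hypothesis a_gt0 : 0 < a.
Hypothesis muE : forall t, 0 <= t -> mu `]t, +oo[%classic = (expR (- (a * t)))%:E.
Context (k : nat) (M : iid_model mu k).
Context d (S : measurableType d) (P : probability S R) (W : S -> R).
Hypothesis mW : measurable_fun setT W.
Local Notation PM := (P \x iid_prob M)%E.

(** About [expR (a * W z)] particles are present, up to the cap [k]: the maximum of that many
    exponential lifetimes of rate [a] concentrates at [W z] when [a] is large. *)
Definition threshold (i : nat) (z : S) : bool := i%:R <= expR (a * W z).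

Lemma measurable_threshold i : measurable [set z | threshold i z].
Proof.
rewrite (_ : [set z | _] = setT `&` (fun z => expR (a * W z)) @^-1` `[i%:R, +oo[).
  apply: measurableT_comp => //; exact: measurable_funM.
by apply/seteqP; split => z /=; rewrite in_itv/= andbT // => -[].
Qed.

Local Notation Y := (last_death (M := M) threshold).

Lemma measurable_last_death_le y : measurable [set w | Y w <= y].
Proof.
rewrite (_ : [set w | _] = setT `&` Y @^-1` `]-oo, y]).
  by apply: measurable_last_death => //; exact: measurable_threshold.
by apply/seteqP; split => z /=; rewrite in_itv/= // => -[].
Qed.

Lemma xsection_last_death_le y z : 0 <= y ->
  iid_prob M (xsection [set w | Y w <= y] z) =
  ((1 - expR (- (a * y))) ^+ minn k (Num.truncn (expR (a * W z))).+1)%:E.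
Proof.
move=> y0; rewrite -prod_threshold ?expR_ge0//.
rewrite -[RHS](xsection_dead muE M threshold z y0).
congr (iid_prob M (xsection _ _)); apply/seteqP; split => w /=.
  by move=> /last_death_le[].
by move=> h; apply/last_death_le.
Qed.

Lemma survival_itv y : 0 <= y -> 0 <= expR (- (a * y)) <= 1.
Proof.
by move=> y0; rewrite expR_ge0 -expR0 ler_expR oppr_le0 mulr_ge0// ltW.
Qed.

Lemma measurable_W_fst (A : set (measurableTypeR R)) : measurable A ->
  measurable [set w : S * iid_space M | A (W w.1)].
Proof.
move=> mA; rewrite -[X in measurable X]setTI.
by apply: (measurableT_comp mW measurable_fst).
Qed.

(** When [b <= W], at least [expR (a * b)] particles are present, the bound on [k] ensuring that the
    cap does not interfere. All are dead by [y] with probability at most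
    [expR (- expR (a * (b - y)))]. *)
Lemma early_last_death (b y : R) : 0 <= y -> expR (a * b) <= k%:R ->
  (PM [set w | (b <= W w.1)%R /\ (Y w <= y)%R] <= (expR (- (a * (b - y))))%:E)%E.
Proof.
move=> y0 bk; apply: product_le.
  apply: measurableI (measurable_last_death_le y).
  rewrite (_ : (fun w => _) = [set w | `[b, +oo[%classic (W w.1)]).
    exact: measurable_W_fst.
  by apply/funext => w /=; rewrite in_itv/= andbT.
move=> z; have [bW|Wb] := leP b (W z); last first.
  rewrite (_ : xsection _ _ = set0) ?measure0 ?lee_fin ?expR_ge0//.
  apply/seteqP; split => e //=; rewrite /xsection/= inE/= => -[].
  by rewrite leNgt Wb.
rewrite (_ : xsection _ _ = xsection [set w | Y w <= y] z); last first.
  by apply/seteqP; split => e; rewrite /xsection/= !inE/=; [case|].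
rewrite xsection_last_death_le// lee_fin.
apply: le_trans (threshold_upper (survival_itv y0) (expR_ge0 _) _ bk) _.
  by rewrite ler_expR ler_pM2l.
rewrite ler_expR lerN2 -expRD (_ : - _ + _ = a * (b - y)); last by ring.
(* The double exponential is weakened to a simple one, enough for convergence to 0. *)
by have := expR_ge1Dx (a * (b - y)); lra.
Qed.

(** When [W <= b], at most [expR (a * b) + 1] particles are present, and each survives [y] with
    probability [expR (- (a * y))]. The second term of the bound comes from the extra particle. *)
Lemma late_last_death (b y : R) : 0 <= y ->
  (PM [set w | (W w.1 <= b)%R /\ (y < Y w)%R] <=
   (expR (- (a * (y - b))) + expR (- (a * y)))%:E)%E.
Proof.
move=> y0; have mYC : measurable [set w | y < Y w].
  rewrite (_ : mkset _ = ~` [set w | Y w <= y]).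
    by apply: measurableC; exact: measurable_last_death_le.
  by apply/seteqP; split => w /=; rewrite ltNge => /negP.
apply: product_le.
  apply: measurableI mYC.
  rewrite (_ : (fun w => _) = [set w | `]-oo, b]%classic (W w.1)]).
    exact: measurable_W_fst.
  by apply/funext => w /=; rewrite in_itv/=.
move=> z; have [Wb|bW] := leP (W z) b; last first.
  rewrite (_ : xsection _ _ = set0) ?measure0 ?lee_fin ?addr_ge0 ?expR_ge0//.
  apply/seteqP; split => e //=; rewrite /xsection/= inE/= => -[].
  by rewrite leNgt bW.
rewrite (_ : xsection _ _ = ~` xsection [set w | Y w <= y] z); last first.
  apply/seteqP; split => e; rewrite /xsection/= !inE/= ltNge; first by move=> [_ /negP].
  by move=> /negP.
rewrite probability_setC; last first.
  by apply: measurable_xsection; exact: measurable_last_death_le.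
rewrite xsection_last_death_le// -EFinB lee_fin.
apply: le_trans (threshold_lower _ (survival_itv y0) (expR_ge0 _)) _.
rewrite mulrDl mul1r lerD2r -expRD ler_expR.
have : a * W z <= a * b by rewrite ler_pM2l.
lra.
Qed.

End threshold_process.

(** * Convergence in distribution *)

Lemma product_fst (R : realType) d1 d2 (T1 : measurableType d1)
    (T2 : measurableType d2) (P1 : probability T1 R) (P2 : probability T2 R)
    (A : set T1) : measurable A -> ((P1 \x P2) (fst @^-1` A) = P1 A)%E.
Proof.
move=> mA; rewrite (_ : fst @^-1` A = A `*` setT); last first.
  by apply/seteqP; split => -[x y] //= -[].
by rewrite product_measure1E// [X in (_ * X)%E]probability_setT mule1.
Qed.

Lemma product_snd (R : realType) d1 d2 (T1 : measurableType d1)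
    (T2 : measurableType d2) (P1 : probability T1 R) (P2 : probability T2 R)
    (B : set T2) : measurable B -> ((P1 \x P2) (snd @^-1` B) = P2 B)%E.
Proof.
move=> mB; rewrite (_ : snd @^-1` B = setT `*` B); last first.
  by apply/seteqP; split => -[x y] //= -[].
by rewrite product_measure1E// [X in (X * _)%E]probability_setT mul1e.
Qed.

(** The shift [e] is fixed first and absorbed by the continuity of the limit at [x]; only then does
    [n] grow to make [b n] small. *)
Lemma cvg_in_distribution_sandwich (R : realType) (X : nat -> rvar R)
    (Z : rvar R) :
  (forall x e : R, 0 < e -> exists2 b : nat -> R, b n @[n --> \oo] --> 0 &
    \forall n \near \oo,
      (rvar_cdf (X n) x <= rvar_cdf Z (x + e) + (b n)%:E)%E /\
      (rvar_cdf Z (x - e) <= rvar_cdf (X n) x + (b n)%:E)%E) ->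
  cvg_in_distribution X Z.
Proof.
move=> sandwich x Zx.
pose f (U : rvar R) y := fine (rvar_cdf U y).
have fE U y : rvar_cdf U y = (f U y)%:E by rewrite /f fineK// fin_num_measure.
have fx : f Z y @[y --> x] --> f Z x.
  by apply: fine_cvg; rewrite -fE; exact: Zx.
rewrite fE; under eq_fun do rewrite fE; apply: cvg_EFin; first exact: nearW.
apply/cvgrPdist_le => r r0 /=; have r20 : 0 < r / 2 by rewrite divr_gt0.
have /cvgrPdist_le/(_ _ r20)[s /= s0 fs] := fx.
have s20 : 0 < s / 2 by rewrite divr_gt0.
have [b b0 bn] := sandwich x _ s20.
have /cvgrPdist_le/(_ _ r20) b0r := b0.
have fxD : `|f Z x - f Z (x + s / 2)| <= r / 2.
  by apply: fs; rewrite /ball/= opprD addNKr normrN gtr0_norm//; lra.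
have fxB : `|f Z x - f Z (x - s / 2)| <= r / 2.
  by apply: fs; rewrite /ball/= opprB addrCA subrr addr0 gtr0_norm//; lra.
near=> n; have [] : (rvar_cdf (X n) x <= rvar_cdf Z (x + s / 2) + (b n)%:E)%E /\
    (rvar_cdf Z (x - s / 2) <= rvar_cdf (X n) x + (b n)%:E)%E by near: n.
have : `|0 - b n| <= r / 2 by near: n.
rewrite !fE -!EFinD !lee_fin; move: fxD fxB; rewrite !ler_norml; lra.
Unshelve. all: by end_near. Qed.

(** Convergence in law to a constant implies convergence in probability: the limiting distribution
    function is continuous at [c - e] and at [c + e], with values 0 and 1. *)
Lemma cvg_in_distribution_const (R : realType) (X : nat -> rvar R) (c e : R) :
  cvg_in_distribution X (const_rvar c) -> 0 < e ->
  exists2 b : nat -> R, b n @[n --> \oo] --> 0 &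
    forall n, (rv_prob (X n) [set w | ~ (c - e < rv_fun (X n) w <= c + e)%R] <=
      (b n)%:E)%E.
Proof.
move=> Xc e0.
have cdfc y : rvar_cdf (const_rvar c) y = ((c <= y)%R%:R : R)%:E.
  rewrite /rvar_cdf /cdf /distribution /pushforward/= diracE.
  by congr (nat_of_bool _)%:R%:E; apply/idP/idP; rewrite inE/= in_itv/=.
have cvgF y : y != c -> rvar_cdf (X n) y @[n --> \oo] --> ((c <= y)%R%:R : R)%:E.
  move=> yc; rewrite -cdfc; apply: Xc.
  apply: cvg_near_cst; case: (ltgtP c y) yc => // cy _; near=> z; rewrite !cdfc.
    by rewrite !ltW//; near: z; exact: cvgr_gt cvg_id _ cy.
  by rewrite !leNgt cy (_ : z < c)//; near: z; exact: cvgr_lt cvg_id _ cy.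
pose F n y := fine (rvar_cdf (X n) y).
have FE n y : rvar_cdf (X n) y = (F n y)%:E by rewrite /F fineK// fin_num_measure.
have cvgF' y : y != c -> F n y @[n --> \oo] --> ((c <= y)%R%:R : R).
  by move=> yc; apply: fine_cvg; exact: cvgF.
exists (fun n => F n (c - e) + (1 - F n (c + e))).
  have F0 : F n (c - e) @[n --> \oo] --> (0 : R).
    have cce : (c <= c - e) = false by apply/negbTE; rewrite -ltNge ltrBlDr ltrDl.
    have := cvgF' (c - e); rewrite cce; apply.
    by apply/eqP => ec; rewrite ec lexx in cce.
  have F1 : F n (c + e) @[n --> \oo] --> (1 : R).
    have := cvgF' (c + e); rewrite lerDl (ltW e0); apply.
    by rewrite gt_eqF// ltrDl.
  rewrite -[X in _ --> X]add0r -[X in _ --> _ + X](subrr 1).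
  by apply: cvgD => //; apply: cvgB => //; exact: cvg_cst.
move=> n; rewrite EFinD EFinB -!FE.
have mX := @measurable_funPTI _ _ _ _ (rv_fun (X n)).
have -> : (1 - rvar_cdf (X n) (c + e))%E =
    rv_prob (X n) (rv_fun (X n) @^-1` ~` `]-oo, c + e]).
  by rewrite preimage_setC probability_setC//; exact: (mX `]-oo, c + e]%classic).
apply: (@le_trans _ _ (rv_prob (X n) (rv_fun (X n) @^-1` `]-oo, c - e] `|`
    rv_fun (X n) @^-1` ~` `]-oo, c + e]))).
  apply: le_measure; rewrite ?inE.
  - rewrite (_ : mkset _ = rv_fun (X n) @^-1` ~` `]c - e, c + e]).
      by apply: mX; exact: measurableC.
    by apply/seteqP; split => w /=; rewrite in_itv.
  - by apply: measurableU; apply: mX => //; exact: measurableC.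
  - move=> w /= /negP; rewrite negb_and -!leNgt !in_itv/= -ltNge.
    by case/orP => h; [left|right; apply/negP; rewrite -ltNge].
by apply: measureU2; apply: mX => //; exact: measurableC.
Unshelve. all: by end_near. Qed.

Lemma measurable_preimage_fst d1 d2 (T1 : measurableType d1)
    (T2 : measurableType d2) (A : set T1) :
  measurable A -> measurable (fst @^-1` A : set (T1 * T2)).
Proof. by move=> mA; rewrite -[X in measurable X]setTI; exact: measurable_fst. Qed.

Lemma measurable_preimage_snd d1 d2 (T1 : measurableType d1)
    (T2 : measurableType d2) (B : set T2) :
  measurable B -> measurable (snd @^-1` B : set (T1 * T2)).
Proof. by move=> mB; rewrite -[X in measurable X]setTI; exact: measurable_snd. Qed.

Definition rv_of (R : realType) d (T : measurableType d) (P : probability T R)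
    (f : T -> R) (mf : measurable_fun setT f) : {RV P >-> R} :=
  mfun_Sub (mem_set mf).

(** * The ratio of the last death to an independent copy of [Theta] *)

Section ratio.
Context {R : realType} (a : R) (mu : probability (measurableTypeR R) R).
Hypothesis a_gt0 : 0 < a.
Hypothesis muE : forall t, 0 <= t -> mu `]t, +oo[%classic = (expR (- (a * t)))%:E.
Context (k : nat) (M : iid_model mu k) (c : R) (Z Theta : rvar R).
Hypothesis c_gt0 : 0 < c.

Let W (z : rv_space Z) : R := c * rv_fun Z z.
Let mW : measurable_fun setT W.
Proof. by apply: measurable_funM => //; exact: measurable_funPT. Qed.

Local Notation Y := (last_death (M := M) (threshold a W)).
Local Notation PM := (rv_prob Z \x iid_prob M)%E.
Local Notation Omega := ((rv_space Z * iid_space M) * rv_space Theta)%type.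
Local Notation PP := (PM \x rv_prob Theta)%E.

Let mY : measurable_fun setT Y.
Proof. by apply: measurable_last_death => i; exact: measurable_threshold. Qed.

Definition ratio_num (w : Omega) : R := Y w.1.
Definition ratio_den (w : Omega) : R := rv_fun Theta w.2.

Lemma measurable_ratio_num : measurable_fun setT ratio_num.
Proof. exact: measurableT_comp mY measurable_fst. Qed.

Lemma measurable_ratio_den : measurable_fun setT ratio_den.
Proof. exact: measurableT_comp (measurable_funPT (rv_fun Theta)) measurable_snd. Qed.

Lemma measurable_ratio : measurable_fun setT (fun w => ratio_num w / ratio_den w).
Proof.
apply: measurable_funM; first exact: measurable_ratio_num.
exact: measurableT_comp (@measurable_inv R) measurable_ratio_den.
Qed.

(** The numerator lives on the product of the space of [Z] with that of the lifetimes, and the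
    denominator on a further factor. So the numerator depends on [Z] while being independent of the
    denominator. *)
Definition ratio_rvar : rvar R := @RVar R _ Omega PP (rv_of PP measurable_ratio).

Lemma ratio_rvar_in_class (C : rvar R -> Prop) : (0 < k)%N -> C Theta ->
  PH_ratio_class C ratio_rvar.
Proof.
move=> k0 CT; exists Theta => //.
exists (rv_of PP measurable_ratio_num), (rv_of PP measurable_ratio_den); split.
- apply: (phase_type_last_death a_gt0 muE (measurable_threshold _ mW) k0 _
    (tau := rv_of PM mY)) => //.
    (* Particle 0 is present in every environment, since its threshold is 0. *)
    by move=> z; rewrite /threshold expR_ge0.
  by move=> A mA; apply/esym/product_fst; rewrite -[X in measurable X]setTI; exact: mY.
- by move=> A mA; apply: product_snd; exact: measurable_funPTI.
- move=> A B mA mB.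
  have mYA : measurable (Y @^-1` A) by rewrite -[X in measurable X]setTI; exact: mY.
  have mTB : measurable (rv_fun Theta @^-1` B) by exact: measurable_funPTI.
  rewrite (_ : _ `&` _ = (Y @^-1` A) `*` (rv_fun Theta @^-1` B))//.
  etransitivity; first exact: product_measure1E.
  by congr (_ * _)%E; apply/esym; [exact: product_fst|exact: product_snd].
- by [].
Qed.

Local Notation bad e := [set w | ~ (c - e < rv_fun Theta w <= c + e)%R].

Let measurable_bad (e : R) : measurable (bad e).
Proof.
rewrite (_ : mkset _ = ~` (rv_fun Theta @^-1` `]c - e, c + e])).
  by apply: measurableC; exact: measurable_funPTI.
by apply/seteqP; split => w /=; rewrite in_itv.
Qed.

Let measurable_W_Y (A B : set (measurableTypeR R)) :
  measurable A -> measurable B -> measurable [set w | A (W w.1) /\ B (Y w)].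
Proof.
move=> mA mB; apply: measurableI; first exact: measurable_W_fst.
by rewrite -[X in measurable X]setTI; exact: mY.
Qed.

Let ratio_le x : set Omega := [set w | ratio_num w / ratio_den w <= x].

Let measurable_ratio_le x : measurable (ratio_le x).
Proof.
rewrite (_ : ratio_le x = setT `&`
    (fun w => ratio_num w / ratio_den w) @^-1` `]-oo, x]).
  exact: measurable_ratio.
by apply/seteqP; split => w /=; rewrite in_itv/= // => -[].
Qed.

Let ratio_cdfE x : rvar_cdf ratio_rvar x = PP (ratio_le x).
Proof.
congr (PP _); apply/seteqP; split => w; rewrite /ratio_le/= in_itv//.
Qed.

(** If the ratio is at most [x] and [Theta] is close to [c], then [Y <= x * (c + e)]. So either
    [Z <= x + d], or the last death is early for the level [c * (x + d)], with a gap of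
    [c * d - x * e]. *)
Lemma ratio_cdf_le (x d e : R) : 0 <= x -> 0 < e < c -> expR (a * (c * (x + d))) <= k%:R ->
  (rvar_cdf ratio_rvar x <= rvar_cdf Z (x + d) +
    (rv_prob Theta (bad e) + (expR (- (a * (c * d - x * e))))%:E))%E.
Proof.
move=> x0 /andP[e0 ec] bk.
pose early := [set w | c * (x + d) <= W w.1 /\ Y w <= x * (c + e)].
have mearly : measurable early.
  rewrite (_ : early = [set w | `[c * (x + d), +oo[%classic (W w.1) /\
                                `]-oo, x * (c + e)]%classic (Y w)]).
    exact: measurable_W_Y.
  by apply/seteqP; split => w /=; rewrite !in_itv/= andbT.
have early_le : (PM early <= (expR (- (a * (c * d - x * e))))%:E)%E.
  rewrite (_ : c * d - x * e = c * (x + d) - x * (c + e)); last by ring.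
  apply: (early_last_death a_gt0 muE) => //; rewrite mulr_ge0// addr_ge0// ltW//.
have mZ := measurable_funPTI (rv_fun Z).
rewrite ratio_cdfE; set A := rv_fun Z @^-1` `]-oo, x + d].
have mA : measurable A by exact: mZ.
have mA1 : measurable (fst @^-1` A : set (rv_space Z * iid_space M)).
  exact: measurable_preimage_fst.
have mA2 : measurable (fst @^-1` (fst @^-1` A) : set Omega).
  exact: measurable_preimage_fst.
have mbad : measurable (snd @^-1` bad e : set Omega).
  exact: measurable_preimage_snd.
have mearly2 : measurable (fst @^-1` early : set Omega).
  exact: measurable_preimage_fst.
apply: (@le_trans _ _ (PP (fst @^-1` (fst @^-1` A) `|`
    (snd @^-1` bad e `|` fst @^-1` early)))).
  apply: le_measure; rewrite ?inE.
  - exact: measurable_ratio_le.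
  - by apply: measurableU => //; exact: measurableU.
  - move=> w /= Xx.
    have [Zx|xZ] := leP (rv_fun Z w.1.1) (x + d); first by left; rewrite /A/= in_itv.
    right; have [/andP[Te eT]|] := boolP (c - e < rv_fun Theta w.2 <= c + e); last first.
      by move=> /negP; left.
    right; split; first by rewrite ler_pM2l// ltW.
    have T0 : 0 < rv_fun Theta w.2 by apply: lt_trans Te; rewrite subr_gt0.
    move: Xx; rewrite /ratio_le/= /ratio_num /ratio_den ler_pdivrMr// => /le_trans; apply.
    by rewrite ler_wpM2l.
apply: le_trans (measureU2 _ _ _) _ => //; first exact: measurableU.
apply: leeD.
  have PA : PP (fst @^-1` (fst @^-1` A)) = rvar_cdf Z (x + d).
    by etransitivity; exact: product_fst.
  by rewrite -PA.
apply: le_trans (measureU2 _ _ _) _ => //; apply: leeD.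
  by rewrite -(product_snd PM).
by apply: le_trans early_le; rewrite -(product_fst _ (rv_prob Theta)).
Qed.

(** If [Z <= x - d] and [Theta] is close to [c], then either [Y <= x * (c - e)], which makes the
    ratio at most [x], or the last death is late, with the same gap [c * d - x * e]. *)
Lemma ratio_cdf_ge (x d e : R) : 0 < x -> 0 < e < c ->
  (rvar_cdf Z (x - d) <= rvar_cdf ratio_rvar x +
    (rv_prob Theta (bad e) +
     (expR (- (a * (c * d - x * e))) + expR (- (a * (x * (c - e)))))%:E))%E.
Proof.
move=> x0 /andP[e0 ec]; have y0 : 0 <= x * (c - e).
  by rewrite mulr_ge0 ?subr_ge0// ltW.
pose late := [set w | W w.1 <= c * (x - d) /\ x * (c - e) < Y w].
have mlate : measurable late.
  rewrite (_ : late = [set w | `]-oo, c * (x - d)]%classic (W w.1) /\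
                                `]x * (c - e), +oo[%classic (Y w)]).
    exact: measurable_W_Y.
  by apply/seteqP; split => w /=; rewrite !in_itv/= andbT.
have late_le : (PM late <= (expR (- (a * (c * d - x * e))) +
    expR (- (a * (x * (c - e)))))%:E)%E.
  rewrite (_ : c * d - x * e = x * (c - e) - c * (x - d)); last by ring.
  exact: (late_last_death a_gt0 muE).
have mZ := measurable_funPTI (rv_fun Z).
rewrite ratio_cdfE; set A := rv_fun Z @^-1` `]-oo, x - d].
have mA : measurable A by exact: mZ.
have mA1 : measurable (fst @^-1` A : set (rv_space Z * iid_space M)).
  exact: measurable_preimage_fst.
have mA2 : measurable (fst @^-1` (fst @^-1` A) : set Omega).
  exact: measurable_preimage_fst.
have mbad : measurable (snd @^-1` bad e : set Omega).
  exact: measurable_preimage_snd.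
have mlate2 : measurable (fst @^-1` late : set Omega).
  exact: measurable_preimage_fst.
have -> : rvar_cdf Z (x - d) = PP (fst @^-1` (fst @^-1` A)).
  by apply/esym; etransitivity; exact: product_fst.
apply: (@le_trans _ _ (PP (ratio_le x `|`
    (snd @^-1` bad e `|` fst @^-1` late)))).
  apply: le_measure; rewrite ?inE.
  - exact: mA2.
  - by apply: measurableU => //; exact: measurableU.
  - move=> w /=; rewrite /A/= in_itv/= => Zx.
    have [/andP[Te eT]|] := boolP (c - e < rv_fun Theta w.2 <= c + e); last first.
      by move=> /negP; right; left.
    have T0 : 0 < rv_fun Theta w.2 by apply: lt_trans Te; rewrite subr_gt0.
    have [Yx|xY] := leP (Y w.1) (x * (c - e)); last first.
      by right; right; split => //; rewrite ler_pM2l.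
    left; rewrite /ratio_le/= /ratio_num /ratio_den ler_pdivrMr//.
    by rewrite (le_trans Yx)// ler_wpM2l// ltW.
apply: le_trans (measureU2 _ _ _) _ => //; first exact: measurableU.
apply: leeD => //; apply: le_trans (measureU2 _ _ _) _ => //; apply: leeD.
  by rewrite -(product_snd PM).
by apply: le_trans late_le; rewrite -(product_fst _ (rv_prob Theta)).
Qed.

(** The last death is nonnegative, and [Theta] is positive when it lies within [e < c] of [c]. *)
Lemma ratio_cdf_lt0 (x e : R) : x < 0 -> 0 < e < c ->
  (rvar_cdf ratio_rvar x <= rv_prob Theta (bad e))%E.
Proof.
move=> x0 /andP[e0 ec]; rewrite ratio_cdfE.
rewrite -[leRHS](product_snd PM)//; apply: le_measure; rewrite ?inE.
- exact: measurable_ratio_le.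
- exact: measurable_preimage_snd.
move=> w; rewrite /ratio_le/= /ratio_num /ratio_den => h /andP[Te _].
have T0 : 0 < rv_fun Theta w.2 by apply: lt_trans Te; rewrite subr_gt0.
have := lt_le_trans (le_lt_trans h x0) (lexx 0).
by rewrite ltNge divr_ge0 ?last_death_ge0// ltW.
Qed.

End ratio.

(** * The approximating sequence and its limit *)

Lemma positive_rvar_cdf (R : realType) (Z : rvar R) (x : R) :
  positive_rvar Z -> x <= 0 -> rvar_cdf Z x = 0%E.
Proof.
move=> Z0 x0; have mZ := measurable_funPTI (rv_fun Z).
have Zpos : [set w | 0 < rv_fun Z w] = rv_fun Z @^-1` `]0, +oo[.
  by apply/seteqP; split => w /=; rewrite in_itv/= andbT.
apply/eqP; rewrite eq_le measure_ge0 andbT.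
rewrite (_ : rvar_cdf Z x = rv_prob Z (rv_fun Z @^-1` `]-oo, x]))//.
apply: (@le_trans _ _ (rv_prob Z (~` [set w | 0 < rv_fun Z w]))).
  apply: le_measure; rewrite ?inE; first exact: mZ.
  - by rewrite Zpos; apply: measurableC; exact: mZ.
  - by move=> w /=; rewrite in_itv/= => Zx; apply/negP; rewrite -leNgt (le_trans Zx).
by rewrite probability_setC; [rewrite Z0 subee|rewrite Zpos; exact: mZ].
Qed.

Unset Implicit Arguments.
Set Strict Implicit.
Set Printing Implicit Defensive.

Theorem theorem3p3 (R : realType) (C : rvar R -> Prop)
  (C_positive : forall Theta : rvar R, C Theta -> positive_rvar Theta)
  (C_constant : exists (c : R) (Theta : nat -> rvar R),
    [/\ 0 < c, (forall n : nat, C (Theta n)) &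
        cvg_in_distribution Theta (const_rvar c)])
  (Z : rvar R) (Z_positive : positive_rvar Z) :
  exists X : nat -> rvar R,
    (forall n : nat, PH_ratio_class C (X n)) /\ cvg_in_distribution X Z.
Proof.
have [c [T [c0 CT Tc]]] := C_constant.
pose a n : R := n.+1%:R.
have a0 n : 0 < a n by rewrite ltr0n.
pose law n := exponential_law (a0 n).
(* With this cap, [expR (a n * b) <= k n] for any fixed level [b] as soon as [n >= b]. *)
pose k n := (Num.truncn (expR (a n * n%:R))).+1.
pose M n := iid_model_exists (sval (law n)) (k n).
have muE n t : 0 <= t -> sval (law n) `]t, +oo[%classic = (expR (- (a n * t)))%:E.
  exact: (svalP (law n)).
exists (fun n => ratio_rvar (a n) (M n) c Z (T n)); split.
  by move=> n; apply: (ratio_rvar_in_class (a0 n) (muE n)).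
apply: cvg_in_distribution_sandwich => x d d0.
have x1 : 0 < `|x| + 1 by rewrite ltr_wpDl.
(* The first bound keeps [e] below [c]; the second gives [x * e <= c * d / 2], so that the gap
   [c * d - x * e] is positive. Adding 1 to the absolute value avoids a division by 0. *)
pose e := Num.min (c / 2) (c * d / (2 * (`|x| + 1))).
have e0 : 0 < e.
  by rewrite lt_min !divr_gt0 ?mulr_gt0.
have ec : e < c.
  by apply: (@le_lt_trans _ _ (c / 2)); [rewrite ge_min lexx|lra].
have g0 : 0 < c * d - x * e.
  have : (`|x| + 1) * e <= c * d / 2.
    rewrite mulrC -ler_pdivlMr// -[leRHS]mulrA -invfM.
    by rewrite ge_min lexx orbT.
  have : x * e <= `|x| * e by rewrite ler_wpM2r ?ler_norm// ltW.
  have : 0 < c * d by rewrite mulr_gt0.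
  lra.
have e0c : 0 < e < c by rewrite e0.
have [bT bT0 T_bT] := cvg_in_distribution_const Tc e0.
have decay g : 0 < g -> expR (- (a n * g)) @[n --> \oo] --> (0 : R).
  move=> /cvg_expR_decay; rewrite -cvg_shiftS.
  by under eq_fun do rewrite mulrC.
(* This term decays only for [x > 0]. For [x <= 0] the lower estimate is immediate, the distribution
   function of [Z] vanishing at [x - d]. *)
pose late n := if 0 < x then expR (- (a n * (x * (c - e)))) else 0.
have late0 : late n @[n --> \oo] --> (0 : R).
  rewrite /late; case: (ltP 0 x) => x0; last exact: cvg_cst.
  by apply: decay; rewrite mulr_gt0// subr_gt0.
exists (fun n => bT n + (expR (- (a n * (c * d - x * e))) + late n)).
  rewrite -[X in _ --> X]addr0 -[X in _ --> _ + X]addr0.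
  by apply: cvgD => //; apply: cvgD => //; exact: decay.
near=> n; have Tn := T_bT n.
have bk : expR (a n * (c * (x + d))) <= (k n)%:R.
  have /andP[_ /ltW] := truncn_itv (expR_ge0 (a n * n%:R)).
  apply: le_trans; rewrite ler_expR ler_pM2l//.
  by near: n; exact: nbhs_infty_ger.
have late_ge0 : 0 <= late n by rewrite /late; case: ifP => // _; exact: expR_ge0.
split.
  have [x0|x0] := leP 0 x.
    apply: le_trans (ratio_cdf_le (a0 n) (muE n) (M n) Z (T n) c0 x0 e0c bk) _.
    rewrite leeD2l// [leRHS]EFinD leeD// lee_fin lerDl//.
  apply: le_trans (ratio_cdf_lt0 _ _ _ _ x0 e0c) _.
  apply: (le_trans Tn); rewrite -[leLHS]add0e leeD ?measure_ge0//.
  by rewrite lee_fin lerDl addr_ge0 ?expR_ge0.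
have [x0|x0] := ltP 0 x.
  apply: le_trans (ratio_cdf_ge (a0 n) (muE n) (M n) Z (T n) c0 d x0 e0c) _.
  by rewrite leeD2l// [leRHS]EFinD leeD// lee_fin /late x0.
rewrite positive_rvar_cdf//; last by rewrite subr_le0 (le_trans x0)// ltW.
rewrite adde_ge0 ?measure_ge0// lee_fin !addr_ge0 ?expR_ge0//.
by rewrite -lee_fin (le_trans _ Tn).
Unshelve. all: by end_near. Qed.
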